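(* Let $G=(\mathcal X,\mathcal E_G,w)$ be a finite connected weighted graph with induced distance $d_G$, and let $\mu,\nu$ be probability measures on $\mathcal X$. Let $T_\ast$ be a rooted spanning tree of $G$ realizing the minimum in $\min_{T}K_{d_T}(\mu,\nu)$ over all rooted spanning trees $T$ of $G$, and let $\gamma_{T_\ast}$ be an optimal transport plan between $\mu$ and $\nu$ for the ground cost $d_{T_\ast}$. Then $\gamma_{T_\ast}$ is also an optimal transport plan for the ground cost $d_G$, i.e. $$K_{d_G}(\mu,\nu)=\sum_{x,y\in\mathcal X}d_G(x,y)\,\gamma_{T_\ast}(x,y).$$ Moreover, for every $(x,y)\in\mathcal X\times\mathcal X$ with $\gamma_{T_\ast}(x,y)>0$ one has $d_G(x,y)=d_{T_\ast}(x,y)$; that is, the unique path from $x$ to $y$ in $T_\ast$ is a geodesic path of $G$, so all its edges belong to the geodesic graph of $G$.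
   Context: $\mathcal X$ is a finite set; $G=(\mathcal X,\mathcal E_G,w)$ is a connected graph with vertex set $\mathcal X$ and a symmetric weight function $w$ with $w(x,y)>0$ for every edge $\{x,y\}\in\mathcal E_G$, $x\ne y$, and $w(x,x)=0$. $d_G(x,y)$ is the minimal $w$-length of a path from $x$ to $y$ in $G$. For a distance $d$ on $\mathcal X$, the Kantorovich distance is $K_d(\mu,\nu)=\min_{\gamma\in\Pi(\mu,\nu)}\sum_{x,y}d(x,y)\gamma(x,y)$, where $\Pi(\mu,\nu)$ is the set of probability measures on $\mathcal X\times\mathcal X$ with first marginal $\mu$ and second marginal $\nu$; a minimizer is called an optimal transport plan for the ground cost $d$. It is known that $K_{d_G}(\mu,\nu)=\min_T K_{d_T}(\mu,\nu)$, the minimum being over all rooted spanning trees of $G$. A rooted spanning tree $T$ of $G$ is a subgraph of $G$ that is a tree containing all vertices of $\mathcal X$, with a distinguished root; its edges carry the weights $w$, and $d_T(x,y)$ is the $w$-length of the unique path from $x$ to $y$ in $T$. A geodesic path between two vertices of $G$ is a path whose $w$-length equals their $d_G$-distance. The geodesic graph of $G$ is the spanning subgraph of $G$ consisting of all edges that belong to a geodesic path between some two vertices of $G$. *)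

(* Defs.v *)
From HB Require Import structures.
From mathcomp Require Import all_boot all_order all_algebra.
From mathcomp Require Import all_classical all_reals.

Set Implicit Arguments.
Unset Strict Implicit.
Unset Printing Implicit Defensive.

Import Order.TTheory GRing.Theory Num.Theory.
Local Open Scope classical_set_scope.
Local Open Scope ring_scope.

(* A path visits no vertex twice. It is represented, as in path.v, by its
   starting point x and the sequence p of the vertices that follow x; the
   trivial path from x to x is [::]. *)
Definition is_path (X : finType) (e : rel X) (x y : X) (p : seq X) : Prop :=
  [/\ path e x p, last x p = y & uniq (x :: p)].

Definition steps (X : finType) (x : X) (p : seq X) : seq (X * X) :=
  zip (x :: p) p.

Definition connected_graph (X : finType) (e : rel X) : Prop :=
  forall x y : X, connect e x y.

(* For a symmetric irreflexive relation, cycles of length at most 2 are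
   not cycles of the graph. *)
Definition acyclic_graph (X : finType) (e : rel X) : Prop :=
  forall c : seq X, (2 < size c)%N -> uniq c -> ~~ cycle e c.

(* The weight is unconstrained on pairs of distinct non-adjacent vertices:
   only the weights of edges are ever used. *)
Record weighted_graph (R : realType) (X : finType) : Type := WeightedGraph {
  edge : rel X;
  weight : X -> X -> R;
  edge_sym : symmetric edge;
  edge_irr : irreflexive edge;
  edge_connected : connected_graph edge;
  weight_sym : forall x y : X, weight x y = weight y x;
  weight_gt0 : forall x y : X, edge x y -> 0 < weight x y;
  weight_diag : forall x : X, weight x x = 0
}.

Record rooted_spanning_tree (R : realType) (X : finType)
    (G : weighted_graph R X) : Type := RootedSpanningTree {
  tree_edge : rel X;
  tree_root : X;
  tree_sub : subrel tree_edge (edge G);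
  tree_sym : symmetric tree_edge;
  tree_connected : connected_graph tree_edge;
  tree_acyclic : acyclic_graph tree_edge
}.

Section Graph.
Variables (R : realType) (X : finType) (G : weighted_graph R X).

Definition path_length (x : X) (p : seq X) : R :=
  \sum_(s <- steps x p) weight G s.1 s.2.

(* The infimum is a minimum: the set of paths from x to y is finite and, G
   being connected, nonempty. *)
Definition graph_dist (x y : X) : R :=
  inf [set path_length x p | p in [set p | is_path (edge G) x y p]].

Definition geodesic_path (x y : X) (p : seq X) : Prop :=
  is_path (edge G) x y p /\ path_length x p = graph_dist x y.

Definition geodesic_edge (a b : X) : Prop :=
  exists u v p, geodesic_path u v p /\
    (((a, b) \in steps u p) \/ ((b, a) \in steps u p)).

(* The set of paths from x to y in a tree is a singleton, so that the default
   value of xget is never used. *)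
Definition tree_path (T : rooted_spanning_tree G) (x y : X) : seq X :=
  xget [::] [set p | is_path (tree_edge T) x y p].

Definition tree_dist (T : rooted_spanning_tree G) (x y : X) : R :=
  path_length x (tree_path T x y).

End Graph.

Section Transport.
Variables (R : realType) (X : finType).

Definition is_prob (Y : finType) (p : Y -> R) : Prop :=
  (forall y, 0 <= p y) /\ \sum_y p y = 1.

Definition coupling (mu nu : X -> R) (gamma : X * X -> R) : Prop :=
  [/\ is_prob gamma,
      forall x, \sum_y gamma (x, y) = mu x
    & forall y, \sum_x gamma (x, y) = nu y].

Definition transport_cost (d : X -> X -> R) (gamma : X * X -> R) : R :=
  \sum_x \sum_y d x y * gamma (x, y).

(* When mu and nu are probability measures the infimum is a minimum: the
   couplings then form a nonempty compact set. *)
Definition kantorovich (d : X -> X -> R) (mu nu : X -> R) : R :=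
  inf [set transport_cost d gamma | gamma in [set g | coupling mu nu g]].

Definition optimal_plan (d : X -> X -> R) (mu nu : X -> R)
    (gamma : X * X -> R) : Prop :=
  coupling mu nu gamma /\
  forall gamma', coupling mu nu gamma' ->
    transport_cost d gamma <= transport_cost d gamma'.

End Transport.

(* Main.v *)
(** For every coupling g there is a spanning tree T' with K_{d_T'} at most the
    d_G-cost of g.  Routing g along almost geodesic paths gives a flow on G
    with divergence mu - nu whose cost is almost that of g.  Along a cycle the
    cost is affine as long as no edge changes sign, so that pushing flow around
    the cycle in a direction of nonincreasing cost empties some edge, which can
    then be deleted without disconnecting the graph; eventually the flow lives
    on a spanning tree T'.  Shortcutting the flow at one vertex after the other
    turns it into a coupling, at no extra d_T'-cost by the triangle inequality.

    Hence cost_{d_T}(gamma) <= cost_{d_G}(g) for all g.  As d_G <= d_T, gamma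
    is optimal for d_G; the choice g = gamma forces d_G = d_T wherever
    gamma > 0. *)

Require Import Defs.
From HB Require Import structures.
From mathcomp Require Import all_boot all_order all_algebra.
From mathcomp Require Import all_classical all_reals.
From mathcomp Require Import ring lra.

Set Implicit Arguments.
Unset Strict Implicit.
Unset Printing Implicit Defensive.

Import Order.TTheory GRing.Theory Num.Theory.
Local Open Scope ring_scope.

(** * Rerouting a nonnegative flow into a coupling *)

Section Rerouting.
Variables (R : realType) (X : finType).
Implicit Types (f : X * X -> R) (d : X -> X -> R) (mu nu : X -> R).

Lemma sum_delta (a : X) (h : X -> R) : \sum_x (x == a)%:R * h x = h a.
Proof.
rewrite (bigD1 a) //= eqxx mul1r big1 ?addr0 // => i /negbTE ->.
by rewrite mul0r.
Qed.

(** A loop shifts both marginals at [v] by the same amount, hence keeps the divergence, and is free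
    when [d v v = 0]. *)
Definition add_loop f (v : X) (l : R) (s : X * X) : R :=
  f s + (s.1 == v)%:R * ((s.2 == v)%:R * l).

Lemma add_loop_out f v l x :
  \sum_y add_loop f v l (x, y) = \sum_y f (x, y) + (x == v)%:R * l.
Proof. by rewrite big_split /= -mulr_sumr (sum_delta v (fun=> l)). Qed.

Lemma add_loop_in f v l y :
  \sum_x add_loop f v l (x, y) = \sum_x f (x, y) + (y == v)%:R * l.
Proof.
by rewrite big_split /= (sum_delta v (fun=> (y == v)%:R * l)).
Qed.

Lemma add_loop_cost d f v l : d v v = 0 ->
  transport_cost d (add_loop f v l) = transport_cost d f.
Proof.
move=> dv; apply: eq_bigr => x _; apply: eq_bigr => y _; rewrite /add_loop /=.
have [->|] := eqVneq x v; last by rewrite !mul0r addr0.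
by have [->|] := eqVneq y v; rewrite ?dv ?mul0r ?mul1r ?addr0 // !mul0r addr0.
Qed.

(* Reroutes an amount [k] of the flow through [v] along the direct arcs
   [(x, y)], in proportion to [f (x, v) * f (v, y)]. *)
Definition shortcut f (v : X) (k : R) (s : X * X) : R :=
  let I := \sum_x f (x, v) in let O := \sum_y f (v, y) in
  f s - k / I * ((s.2 == v)%:R * f (s.1, v))
      - k / O * ((s.1 == v)%:R * f (v, s.2))
      + k / (I * O) * (f (s.1, v) * f (v, s.2)).

Section Shortcut.
Variables (f : X * X -> R) (v : X) (k : R).
Hypotheses (f0 : forall s, 0 <= f s) (fvv : f (v, v) = 0).
Let I := \sum_x f (x, v).
Let O := \sum_y f (v, y).
Hypotheses (k0 : 0 < k) (kI : k <= I) (kO : k <= O).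

Let I0 : 0 < I. Proof. exact: lt_le_trans kI. Qed.
Let O0 : 0 < O. Proof. exact: lt_le_trans kO. Qed.
Let nI : I != 0. Proof. by rewrite gt_eqF. Qed.
Let nO : O != 0. Proof. by rewrite gt_eqF. Qed.

(** In row [x] the direct arcs return [k / (I * O) * f (x, v) * O], exactly what the second term
    removes; only the loss of [k / O * O] in row [v] remains. *)
Lemma shortcut_out x :
  \sum_y shortcut f v k (x, y) = \sum_y f (x, y) - (x == v)%:R * k.
Proof.
rewrite /shortcut /= -/I -/O big_split !sumrB /= -!mulr_sumr.
rewrite (sum_delta v (fun=> f (x, v))) -/O.
by field; rewrite nI nO.
Qed.

Lemma shortcut_in y :
  \sum_x shortcut f v k (x, y) = \sum_x f (x, y) - (y == v)%:R * k.
Proof.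
rewrite /shortcut /= -/I -/O big_split !sumrB /= -!mulr_sumr.
rewrite (sum_delta v (fun=> f (v, y))) -mulr_suml -/I.
by field; rewrite nI nO.
Qed.

(** On row and column [v] the product term vanishes because [f (v, v) = 0], and the fractions
    removed, [k / O] and [k / I], are at most 1. *)
Lemma shortcut_ge0 s : 0 <= shortcut f v k s.
Proof.
case: s => x y; rewrite /shortcut /= -/I -/O.
have kI1 : k / I <= 1 by rewrite ler_pdivrMr ?mul1r.
have kO1 : k / O <= 1 by rewrite ler_pdivrMr ?mul1r.
have kIO : 0 <= k / (I * O) by rewrite divr_ge0 ?mulr_ge0 ?ltW.
have [->|_] := eqVneq x v; have [->|_] := eqVneq y v;
  rewrite ?fvv ?mul0r ?mul1r ?mulr0 ?subr0 ?addr0 //.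
- by rewrite -{1}[f (v, y)]mul1r -mulrBl mulr_ge0 ?subr_ge0.
- by rewrite -{1}[f (x, v)]mul1r -mulrBl mulr_ge0 ?subr_ge0.
- by rewrite addr_ge0 ?(mulr_ge0 kIO) ?mulr_ge0.
Qed.

(** By the triangle inequality through [v], the direct arcs cost at most
    [k / (I * O) * (O * A + I * B)], which is exactly the cost removed. *)
Lemma shortcut_cost d : (forall x y, d x y <= d x v + d v y) ->
  transport_cost d (shortcut f v k) <= transport_cost d f.
Proof.
move=> tri; rewrite /transport_cost.
have kIO : 0 <= k / (I * O) by rewrite divr_ge0 ?mulr_ge0 ?ltW.
(* The opaque name keeps the inverse of [I * O] out of the [ring] call below. *)
have [c cE] : {c | c = k / (I * O)} by eexists.
rewrite -cE in kIO.
pose A := \sum_x d x v * f (x, v); pose B := \sum_y d v y * f (v, y).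
have -> : \sum_x \sum_y d x y * shortcut f v k (x, y) =
    \sum_x \sum_y d x y * f (x, y) - k / I * A - k / O * B
    + c * \sum_x \sum_y d x y * (f (x, v) * f (v, y)).
  have -> : A = \sum_x \sum_y (y == v)%:R * (d x y * f (x, v)).
    by apply: eq_bigr => x _; rewrite sum_delta.
  have -> : B = \sum_x \sum_y (x == v)%:R * (d x y * f (v, y)).
    rewrite exchange_big; apply: eq_bigr => y _ /=.
    by rewrite (sum_delta v (fun x => d x y * f (v, y))).
  rewrite !mulr_sumr -!sumrB -big_split; apply: eq_bigr => x _ /=.
  rewrite !mulr_sumr -!sumrB -big_split; apply: eq_bigr => y _ /=.
by rewrite /shortcut -/I -/O /= -cE; ring.
have le : \sum_x \sum_y d x y * (f (x, v) * f (v, y)) <= O * A + I * B.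
  have -> : O * A + I * B =
      \sum_x \sum_y (d x v + d v y) * (f (x, v) * f (v, y)).
    rewrite [O * A]mulrC /A /I /O !mulr_suml -big_split.
    apply: eq_bigr => x _ /=.
    rewrite /B !mulr_sumr -big_split; apply: eq_bigr => y _ /=.
    by ring.
  apply: ler_sum => x _; apply: ler_sum => y _.
  by rewrite ler_wpM2r ?mulr_ge0.
have := ler_wpM2l kIO le.
have -> : c * (O * A + I * B) = k / I * A + k / O * B.
  by rewrite cE; field; rewrite nI nO.
lra.
Qed.

End Shortcut.

(** The divergence condition says that outflow and inflow at [v] exceed [mu v] and [nu v] by the
    same amount. A deficit is filled by a loop, an excess is shortcut; neither touches the marginals
    at other vertices. *)
Lemma balance_vertex d mu nu f v :
  d v v = 0 -> (forall x y, d x y <= d x v + d v y) ->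
  0 <= mu v -> 0 <= nu v -> (forall s, 0 <= f s) ->
  \sum_y f (v, y) - \sum_x f (x, v) = mu v - nu v ->
  exists g, [/\ forall s, 0 <= g s,
    forall x, \sum_y g (x, y) = if x == v then mu v else \sum_y f (x, y),
    forall y, \sum_x g (x, y) = if y == v then nu v else \sum_x f (x, y)
    & transport_cost d g <= transport_cost d f].
Proof.
move=> dv tri mu0 nu0 f0 div.
(* Erasing the loop already present at [v] is free and provides the hypothesis [h (v, v) = 0] of
   [shortcut_ge0]. *)
pose h := add_loop f v (- f (v, v)).
have hvv : h (v, v) = 0 by rewrite /h /add_loop /= eqxx !mul1r subrr.
have h0 s : 0 <= h s.
  case: s => x y; rewrite /h /add_loop /=.
  have [->|_] := eqVneq x v; have [->|_] := eqVneq y v;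
    by rewrite ?mul0r ?mul1r ?mulr0 ?addr0 ?subrr.
have hout x : x != v -> \sum_y h (x, y) = \sum_y f (x, y).
  by move=> /negbTE xv; rewrite add_loop_out xv mul0r addr0.
have hin x : x != v -> \sum_y h (y, x) = \sum_y f (y, x).
  by move=> /negbTE xv; rewrite add_loop_in xv mul0r addr0.
have hdiv : \sum_y h (v, y) - \sum_x h (x, v) = mu v - nu v.
  by rewrite add_loop_out add_loop_in eqxx -div; ring.
rewrite -(add_loop_cost f (- f (v, v)) dv) -/h.
have [ex|ex] := leP (\sum_y h (v, y)) (mu v).
- exists (add_loop h v (mu v - \sum_y h (v, y))).
  split=> [s|x|y|]; last by rewrite add_loop_cost.
  + by rewrite addr_ge0 // ?mulr_ge0 ?subr_ge0.
  + rewrite add_loop_out; case: eqVneq => [->|/hout ->].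
      by rewrite mul1r addrC subrK.
    by rewrite mul0r addr0.
  + rewrite add_loop_in; case: eqVneq => [->|/hin ->].
      by rewrite mul1r; lra.
    by rewrite mul0r addr0.
- set k := \sum_y h (v, y) - mu v.
  have k0 : 0 < k by rewrite subr_gt0.
  have kO : k <= \sum_y h (v, y) by rewrite /k; lra.
  have kI : k <= \sum_x h (x, v) by rewrite /k; lra.
  exists (shortcut h v k).
  split=> [s|x|y|]; [exact: shortcut_ge0| | |exact: shortcut_cost].
  + rewrite shortcut_out //; case: eqVneq => [->|/hout ->].
      by rewrite mul1r /k; ring.
    by rewrite mul0r subr0.
  + rewrite shortcut_in //; case: eqVneq => [->|/hin ->].
      by rewrite mul1r /k; lra.
    by rewrite mul0r subr0.
Qed.

(** Vertices are balanced one by one, and those already treated stay balanced. Only the first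
    marginal is tracked: the divergence then determines the second. *)
Lemma flow_to_coupling d mu nu f :
  (forall x, d x x = 0) -> (forall x y z, d x z <= d x y + d y z) ->
  is_prob mu -> is_prob nu -> (forall s, 0 <= f s) ->
  (forall x, \sum_y f (x, y) - \sum_y f (y, x) = mu x - nu x) ->
  exists2 g, coupling mu nu g & transport_cost d g <= transport_cost d f.
Proof.
move=> d0 tri [mu0 mu1] [nu0 _] f0 div.
suff [g [g0 gdiv gout gle]] : exists g, [/\ forall s, 0 <= g s,
    forall x, \sum_y g (x, y) - \sum_y g (y, x) = mu x - nu x,
    forall x, x \in enum X -> \sum_y g (x, y) = mu x
    & transport_cost d g <= transport_cost d f].
  have {}gout x : \sum_y g (x, y) = mu x by rewrite gout ?mem_enum.
  exists g => //; split=> // [|y]; last by have := gdiv y; rewrite gout; lra.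
  split=> //; rewrite -mu1; under [RHS]eq_bigr do rewrite -gout.
  by rewrite pair_bigA; apply: eq_bigr => -[].
elim: (enum X) => [|v s [g [g0 gdiv gout gle]]]; first by exists f.
have [g' [g'0 out' in' le']] :=
  balance_vertex (d0 v) (fun x y => tri x v y) (mu0 v) (nu0 v) g0 (gdiv v).
exists g'; split=> // [x|x|]; last exact: le_trans gle.
- by rewrite out' in'; case: eqVneq => [->|_].
- by rewrite out' inE; case: eqVneq => [->|_] //= /gout.
Qed.

End Rerouting.

(** * Affine perturbations of a weighted sum of absolute values *)

(* The left-hand sum is piecewise affine in [t]; on one side of [0] it is
   nonincreasing until the first zero of some [a i + t * c i]. *)
Lemma affine_breakpoint (R : realType) (I : finType) (P : pred I)
    (w a c : I -> R) :
  (forall i, P i -> 0 < w i) -> (exists2 i, P i & c i != 0) ->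
  exists i t, [/\ P i, c i != 0, a i + t * c i = 0 &
    \sum_(j | P j) w j * `|a j + t * c j| <= \sum_(j | P j) w j * `|a j|].
Proof.
move=> w0.
(* This sum is the slope at 0 once no [a j] with [c j != 0] vanishes. Replacing [c] by [- c] and [t]
   by [- t] reverses its sign. *)
wlog D0 : c / \sum_(j | P j) w j * (Num.sg (a j) * c j) <= 0.
  move=> hw [i Pi ci].
  have [/hw|D0] := leP (\sum_(j | P j) w j * (Num.sg (a j) * c j)) 0.
    by apply; exists i.
  have [||j [t [Pj cj e le]]] := hw (fun j => - c j).
  - under eq_bigr do rewrite !mulrN.
    by rewrite sumrN oppr_le0 ltW.
  - by exists i => //; rewrite oppr_eq0.
  exists j, (- t); split=> //; first by rewrite -oppr_eq0.
  - by rewrite mulNr -mulrN.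
  - by under eq_bigr do rewrite mulNr -mulrN.
case=> i0 Pi0 ci0.
have [/existsP [i /and3P[Pi ci /eqP ai]]|/existsPn an0] :=
    boolP [exists i, [&& P i, c i != 0 & a i == 0]].
  exists i, 0; split=> //; first by rewrite ai mul0r addr0.
  by under eq_bigr do rewrite mul0r addr0.
have ane i : P i -> c i != 0 -> a i != 0.
  by move=> Pi ci; have := an0 i; rewrite Pi ci.
pose Q i := P i && (a i * c i < 0).
(* If no [|a i|] decreased, all terms of the slope would be nonnegative, hence zero by [D0],
   contradicting [ci0]. *)
have [i1 Qi1] : exists i, Q i.
  apply/existsP; apply: contraT => /existsPn nQ.
  have sc_ge0 i : P i -> 0 <= w i * (Num.sg (a i) * c i).
    move=> Pi; rewrite mulr_ge0 ?(ltW (w0 _ Pi)) //.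
    have := nQ i; rewrite /Q Pi /= -leNgt.
    case: sgrP => ai; rewrite ?mul0r // ?mul1r ?mulN1r.
      by rewrite pmulr_rge0.
    by rewrite nmulr_rge0 // oppr_ge0.
  have : \sum_(j | P j) w j * (Num.sg (a j) * c j) = 0.
    by apply/le_anti; rewrite D0 sumr_ge0.
  move/psumr_eq0P => /(_ sc_ge0 _ Pi0) /eqP.
  by rewrite !mulf_eq0 sgr_eq0 (negbTE ci0) (negbTE (ane _ Pi0 ci0)) gt_eqF ?w0.
(* The time at which [a i + t * c i] vanishes. Up to the smallest such time over [Q], no entry
   changes sign. *)
pose tt i := - a i / c i.
case: (arg_minP tt Qi1) => i Qi mini; have /andP[Pi aci] := Qi.
have ci : c i != 0 by apply: contraTneq aci => ->; rewrite mulr0 ltxx.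
have t0 : 0 <= tt i.
  have -> : tt i = - (a i * c i) / c i ^+ 2 by rewrite /tt; field.
  by rewrite divr_ge0 ?sqr_ge0 // oppr_ge0 ltW.
exists i, (tt i); split=> //; first by rewrite /tt divfK // subrr.
apply: (@le_trans _ _ (\sum_(j | P j) (w j * `|a j|
    + tt i * (w j * (Num.sg (a j) * c j))))); last first.
  by rewrite big_split /= -mulr_sumr gerDl mulr_ge0_le0.
apply: ler_sum => j Pj; rewrite mulrCA -mulrDr ler_wpM2l ?(ltW (w0 _ Pj)) //.
have tj : a j * c j < 0 -> tt i <= - a j / c j.
  by move=> acj; apply: mini; rewrite /Q Pj.
case: (sgrP (a j)) tj (ane j Pj) => aj tj nj.
- have [cj|/nj] := eqVneq (c j) 0; last by [].
  by rewrite aj cj !mulr0 !addr0 normr0.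
- rewrite mul1r ger0_norm //.
  have [cj|cj] := leP 0 (c j).
    by rewrite (addr_ge0 (ltW aj)) ?(mulr_ge0 t0).
  have := tj; rewrite pmulr_rlt0 // ler_ndivlMr // => /(_ cj).
  lra.
- rewrite mulN1r mulrN -opprD ler0_norm //.
  have [cj|cj] := leP (c j) 0.
    by rewrite (ler_wnDl (ltW aj)) ?(mulr_ge0_le0 t0).
  have := tj; rewrite nmulr_rlt0 // ler_pdivlMr // => /(_ cj).
  lra.
Qed.

(** * Uniqueness of paths in acyclic graphs, and deletion of a cycle edge *)

Section Acyclic.
Variables (X : finType) (e : rel X).

Lemma steps_split (a b x : X) p : (a, b) \in steps x p ->
  exists p1 p2, p = p1 ++ b :: p2 /\ last x p1 = a.
Proof.
elim: p x => [|y p IH] x //; rewrite inE => /predU1P [[-> ->]|/IH].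
  by exists [::], p.
by move=> [p1 [p2 [-> <-]]]; exists (y :: p1), p2.
Qed.

Lemma steps_edge (a b x : X) p : path e x p -> (a, b) \in steps x p -> e a b.
Proof.
move=> ep /steps_split [p1 [p2 [pE <-]]].
by move: ep; rewrite pE cat_path /= => /and3P[].
Qed.

(** If the paths left [x] towards distinct [a] and [b], their remainders would join [a] to [b]
    avoiding [x], and adding [x] would close a cycle. *)
Lemma acyclic_path_inj x y p q : symmetric e -> acyclic_graph e ->
  is_path e x y p -> is_path e x y q -> p = q.
Proof.
move=> esym eac; elim: p x q => [|a p IH] x [|b q] //=.
- by move=> [_ /= -> _] [_ /= bq]; rewrite -bq mem_last.
- by move=> [_ /= bq +] [_ /= yx _]; rewrite yx -bq /= mem_last.
move=> [/= /andP[xa ap] lp /andP[xp up]] [/= /andP[xb bq] lq /andP[xq uq]].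
have [ab|neq_ab] := eqVneq a b.
  by subst b; congr cons; apply: (IH a).
pose e' := [rel u v | [&& e u v, u != x & v != x]].
have conn z r : path e z r -> x \notin z :: r -> connect e' z (last z r).
  elim: r z => [|c r IHr] z /=; first by rewrite connect0.
  move=> /andP[zc cr]; rewrite inE negb_or => /andP[xz xr].
  apply: connect_trans (IHr _ cr xr); apply: connect1 => /=.
  by rewrite zc eq_sym xz; move: xr; rewrite inE negb_or eq_sym => /andP[].
have esym' : connect_sym e'.
  by apply: sym_connect_sym => u v /=; rewrite esym [(u != x) && _]andbC.
have : connect e' a b.
  apply: connect_trans (conn _ _ ap xp) _.
  by rewrite esym' lp -lq conn.
case/connectP => r0 /shortenP [r er ur _] lr.
have xr : x \notin a :: r.
  rewrite inE negb_or; apply/andP; split.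
    by move: xp; rewrite inE negb_or => /andP[].
  elim: (r) (a) er => // c r' IHr z /= /andP[/and3P[_ _ cx] /IHr xr'].
  by rewrite inE negb_or eq_sym cx.
have er' : path e a r by apply: sub_path er => u v /and3P[].
(* As [a] and [b] differ, [r] is nonempty, so the cycle has the required three vertices. *)
have := eac (x :: a :: r).
rewrite /= ltnS; case: r => [|c r] in ur lr xr er er' *.
  by rewrite lr eqxx in neq_ab.
move=> /(_ isT) /=; rewrite -/(uniq (c :: r)).
have -> : x \notin a :: c :: r by [].
move=> /(_ ur) /negP[]; rewrite xa /= rcons_path /=.
move: er' => /= /andP[-> ->] /=.
by rewrite -[last c r]/(last a (c :: r)) -lr esym.
Qed.

Definition del_edge (a b : X) : rel X :=
  [rel u v | e u v && ~~ ((u, v) \in [:: (a, b); (b, a)])].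

Lemma del_edge_sym a b : symmetric e -> symmetric (del_edge a b).
Proof.
move=> esym u v; rewrite /del_edge /= esym !inE !xpair_eqE.
by rewrite orbC (andbC (u == b)) (andbC (u == a)).
Qed.

Lemma del_edge_path a b z r : path e z r -> b \notin z :: r ->
  path (del_edge a b) z r.
Proof.
elim: r z => // y r IHr u /= /andP[uy yr].
rewrite inE negb_or => /andP[bu bnr]; rewrite IHr // andbT /del_edge /= uy !inE.
rewrite !xpair_eqE ![u == b]eq_sym (negbTE bu) orbF /=.
by move: bnr; rewrite inE negb_or eq_sym => /andP[/negbTE ->]; rewrite andbF.
Qed.

(** The rest of the cycle, followed from [b] round to [a], replaces the deleted edge. *)
Lemma del_edge_connected a b x c : symmetric e -> connected_graph e ->
  (2 < size (x :: c))%N -> uniq (x :: c) -> path e x (rcons c x) ->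
  (a, b) \in steps x (rcons c x) -> connected_graph (del_edge a b).
Proof.
move=> esym econ sz unq ecyc /steps_split [p1 [p2 [cE lp1]]].
have es := sym_connect_sym (del_edge_sym a b esym).
suff ba : connect (del_edge a b) b a.
  move=> u v; apply: connect_sub (econ u v) => {}u {}v uv.
  have [|nab] := boolP ((u, v) \in [:: (a, b); (b, a)]).
    by rewrite !inE !xpair_eqE => /orP[] /andP[/eqP -> /eqP ->] //; rewrite es.
  by apply: connect1; rewrite /del_edge /= uv.
have lp2 : last b p2 = x by rewrite -[x in RHS](last_rcons x c) cE last_cat.
pose q := p2 ++ p1.
have pq : perm_eq (x :: c) (b :: q).
  by rewrite -[b :: q]/((b :: p2) ++ p1) -(perm_rcons x c) cE perm_catC.
have uq : uniq (b :: q) by rewrite -(perm_uniq pq).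
have szq : (1 < size q)%N by have := perm_size pq; move: sz => /= + [<-].
have eq : path e b q.
  move: ecyc; rewrite cE cat_path /= => /and3P[ep1 _ ep2].
  by rewrite cat_path ep2 lp2.
have lq : last b q = a by rewrite last_cat lp2.
(* The detour has at least two steps: the first one goes to [z != a], and the later ones avoid [b],
   so none is the deleted edge. *)
case: q => [|z [|z' q]] // in uq szq eq lq {pq} *.
apply/connectP; exists [:: z, z' & q] => //.
have bq : b \notin [:: z, z' & q] by case/andP: uq.
have za : z != a.
  apply: contraTneq uq => ->; rewrite -lq /= mem_last.
  by rewrite andbF.
move: eq => /= /andP[bz ep].
apply/andP; split.
  rewrite /del_edge /= bz !inE !xpair_eqE (negbTE za) andbF orbF.
  apply/negP => /andP[_ /eqP zb]; by rewrite zb mem_head in bq.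
exact: (@del_edge_path a b z (z' :: q)).
Qed.

End Acyclic.

(** * Antisymmetric unit flows along walks *)

Section PathFlow.
Variables (R : realType) (X : finType).

Definition path_flow (x : X) (p : seq X) (a b : X) : R :=
  (count_mem (a, b) (steps x p))%:R - (count_mem (b, a) (steps x p))%:R.

Lemma path_flow_anti x p a b : path_flow x p b a = - path_flow x p a b.
Proof. by rewrite opprB. Qed.

Lemma path_flow_cons x y p a b : path_flow x (y :: p) a b =
  ((x, y) == (a, b))%:R - ((x, y) == (b, a))%:R + path_flow y p a b.
Proof. by rewrite /path_flow /= !natrD; ring. Qed.

(** Steps contribute telescoping differences. In particular closed walks have divergence zero, so
    flow can be pushed around them freely. *)
Lemma path_flow_div x p a :
  \sum_b path_flow x p a b = (x == a)%:R - (last x p == a)%:R.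
Proof.
elim: p x => [|y p IH] x /=.
  by rewrite subrr big1 // => b _; rewrite /path_flow subrr.
under eq_bigr do rewrite path_flow_cons !xpair_eqE.
rewrite big_split sumrB /= IH.
have sum1 (u : X) : \sum_b (u == b)%:R = 1 :> R.
  rewrite (bigD1 u) //= eqxx big1 ?addr0 // => b /negbTE.
  by rewrite eq_sym => ->.
under eq_bigr do rewrite -mulnb natrM.
under [X in _ - X + _]eq_bigr do rewrite -mulnb natrM.
rewrite -mulr_sumr -mulr_suml !sum1; ring.
Qed.

Lemma path_flow_supp x p a b : path_flow x p a b != 0 ->
  (a, b) \in steps x p \/ (b, a) \in steps x p.
Proof.
move=> nz; apply/orP; apply: contraNT nz; rewrite negb_or.
move=> /andP[/count_memPn h1 /count_memPn h2].
by rewrite /path_flow h1 h2 subrr.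
Qed.

(** A third vertex is essential: on a cycle of length two the opposite traversals cancel. Here the
    step from [y] back to [x] would force [y] to be visited again. *)
Lemma cycle_flow_neq0 x y z p : uniq [:: x, y, z & p] ->
  path_flow x (rcons [:: y, z & p] x) x y != 0.
Proof.
move=> u.
have notin : (y, x) \notin steps x (rcons [:: y, z & p] x).
  apply/negP => h; have := h.
  rewrite !inE !xpair_eqE.
  move: u => /= /and3P[]; rewrite !inE !negb_or.
  move=> /and3P[xy xz xp] /andP[yz yp] _.
  rewrite [y == x]eq_sym (negbTE xy) (negbTE xz) /= andbF /=.
  case/steps_split => p1 [p2 [pE p1y]].
  have : y \in z :: rcons p x.
    by rewrite [X in z :: X]pE -cat_cons mem_cat -p1y mem_last.
  rewrite inE mem_rcons inE [y == x]eq_sym (negbTE xy) (negbTE yz).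
  by rewrite (negbTE yp).
rewrite /path_flow (count_memPn notin) subr0 pnatr_eq0 -lt0n -has_count.
by apply/hasP; exists (x, y); rewrite ?inE ?eqxx.
Qed.
End PathFlow.

(** * Path lengths and the graph distance *)

Section Trees.
Variables (R : realType) (X : finType) (G : weighted_graph R X).
Local Notation w := (weight G).

Lemma path_length_nil x : path_length G x [::] = 0.
Proof. exact: big_nil. Qed.

Lemma path_length_cons x y p :
  path_length G x (y :: p) = w x y + path_length G y p.
Proof. exact: big_cons. Qed.

Lemma path_length_cat x p q : path_length G x (p ++ q) =
  path_length G x p + path_length G (last x p) q.
Proof.
elim: p x => [|y p IH] x; first by rewrite path_length_nil add0r.
by rewrite cat_cons !path_length_cons IH addrA.
Qed.

Lemma path_length_ge0 x p : path (edge G) x p -> 0 <= path_length G x p.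
Proof.
elim: p x => [|y p IH] x /=; first by rewrite path_length_nil.
move=> /andP[xy /IH p0].
by rewrite path_length_cons addr_ge0 // ltW // weight_gt0.
Qed.

Lemma is_path_lbound x y : has_lbound
  [set path_length G x p | p in [set p | is_path (edge G) x y p]]%classic.
Proof. by exists 0 => _ [p [/path_length_ge0 ? _ _] <-]. Qed.

Lemma graph_dist_le x y p : is_path (edge G) x y p ->
  graph_dist G x y <= path_length G x p.
Proof. by move=> xyp; apply: (ge_inf (is_path_lbound x y)); exists p. Qed.

Lemma connected_is_path (e : rel X) x y : connected_graph e ->
  exists p, is_path e x y p.
Proof.
move=> /(_ x y) /connectP [p ep ->].
by case/shortenP: ep => p' ep' up' _; exists p'.
Qed.

Lemma graph_dist_adherent x y (eps : R) : 0 < eps ->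
  exists2 p, is_path (edge G) x y p &
    path_length G x p < graph_dist G x y + eps.
Proof.
move=> eps0; have [|_ [p xyp <-] lt] :=
  @inf_adherent _ _ _ eps0 (conj _ (is_path_lbound x y)).
  have [p xyp] := connected_is_path x y (edge_connected G).
  by exists (path_length G x p), p.
by exists p.
Qed.

(** * The metric of a spanning tree *)

Section Tree.
Variable T : rooted_spanning_tree G.

Lemma tree_pathP x y : is_path (tree_edge T) x y (tree_path T x y).
Proof.
have [p xyp] := connected_is_path x y (@tree_connected _ _ _ T).
exact: (@xgetPex _ [::] [set p | is_path (tree_edge T) x y p]%classic
  (ex_intro _ p xyp)).
Qed.

Lemma tree_is_path x y p : is_path (tree_edge T) x y p ->
  is_path (edge G) x y p.
Proof. by case=> /(sub_path (@tree_sub _ _ _ T)). Qed.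

Lemma graph_dist_le_tree x y : graph_dist G x y <= tree_dist T x y.
Proof. exact: graph_dist_le (tree_is_path (tree_pathP x y)). Qed.

Lemma tree_dist_ge0 x y : 0 <= tree_dist T x y.
Proof. by have [/path_length_ge0] := tree_is_path (tree_pathP x y). Qed.

Lemma tree_distE x y p : is_path (tree_edge T) x y p ->
  tree_dist T x y = path_length G x p.
Proof.
move=> xyp; congr path_length.
exact: acyclic_path_inj (@tree_sym _ _ _ T) (@tree_acyclic _ _ _ T)
  (tree_pathP x y) xyp.
Qed.

(** The walk may repeat vertices, which is what the triangle inequality requires. Inductively, [x]
    is put in front of the tree path from [a]; if [x] already lies on that path, its tail from [x]
    is the tree path and the part dropped has nonnegative length. *)
Lemma tree_dist_le x p : path (tree_edge T) x p ->
  tree_dist T x (last x p) <= path_length G x p.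
Proof.
elim: p x => [|a p IH] x /=.
  by move=> _; rewrite (@tree_distE _ _ [::]).
move=> /andP[xa /IH le]; rewrite path_length_cons.
apply: le_trans (lerD (lexx _) le); move: (last a p) {le IH} => z.
have [eq lq uq] := tree_pathP a z; rewrite /(tree_dist T a).
have xaG := tree_sub xa.
have nxa : x != a by apply: contraTneq xaG => ->; rewrite edge_irr.
set q := tree_path T a z in eq lq uq *.
have [xq|xq] := boolP (x \in q); last first.
  rewrite (@tree_distE _ _ (a :: q)) ?path_length_cons //.
  by split=> //=; [rewrite xa | rewrite inE negb_or nxa xq].
case/splitPr: xq eq lq uq => q1 q2.
rewrite -cat_rcons cat_path last_cat last_rcons path_length_cat last_rcons.
move=> /andP[e1 e2] lq; rewrite -cat_cons cat_uniq => /and3P[_ hn u2].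
have xq2 : x \notin q2.
  apply: contra hn => xq2; apply/hasP; exists x => //.
  by rewrite inE mem_rcons mem_head orbT.
rewrite (@tree_distE _ _ q2); last by split; rewrite //= xq2.
rewrite addrA lerDr addr_ge0 ?(ltW (weight_gt0 xaG)) //.
by apply: path_length_ge0; apply: sub_path e1; exact: tree_sub.
Qed.

Lemma tree_dist0 x : tree_dist T x x = 0.
Proof. by rewrite (@tree_distE _ _ [::]) ?path_length_nil. Qed.

Lemma tree_dist_triangle x y z :
  tree_dist T x z <= tree_dist T x y + tree_dist T y z.
Proof.
have [exy lxy _] := tree_pathP x y; have [eyz lyz _] := tree_pathP y z.
have := @tree_dist_le x (tree_path T x y ++ tree_path T y z).
by rewrite cat_path last_cat path_length_cat lxy lyz exy; apply.
Qed.

Lemma tree_dist_edge x y : tree_edge T x y -> tree_dist T x y <= w x y.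
Proof.
move=> xy; have := @tree_dist_le x [:: y].
by rewrite /= xy path_length_cons path_length_nil addr0; apply.
Qed.

Lemma kantorovich_tree_le mu nu g : coupling mu nu g ->
  kantorovich (tree_dist T) mu nu <= transport_cost (tree_dist T) g.
Proof.
move=> cg; apply: ge_inf; last by exists g.
exists 0 => _ [g' [[g'0 _] _ _] <-].
rewrite sumr_ge0 // => x _; rewrite sumr_ge0 // => y _.
by rewrite mulr_ge0 ?tree_dist_ge0.
Qed.

End Tree.

(** * Flows on the graph and their reduction to a spanning tree *)

(** Ordered pairs are summed, so an antisymmetric flow pays twice for each edge; hence the factors 2
    below. *)
Definition flow_cost (F : X -> X -> R) : R :=
  \sum_(s : X * X | edge G s.1 s.2) w s.1 s.2 * `|F s.1 s.2|.

Lemma path_flow_cost x p : path (edge G) x p ->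
  flow_cost (path_flow R x p) <= 2 * path_length G x p.
Proof.
elim: p x => [|y p IH] x /=.
  move=> _; rewrite path_length_nil mulr0 /flow_cost big1 // => s _.
  by rewrite /path_flow subrr normr0 mulr0.
move=> /andP[xy /IH {}IH]; rewrite path_length_cons mulrDr.
have sum1 a b : edge G a b ->
    \sum_(s : X * X | edge G s.1 s.2) w s.1 s.2 * (s == (a, b))%:R = w a b.
  move=> ab; rewrite (bigD1 (a, b)) //= eqxx mulr1 big1 ?addr0 // => s.
  by case/andP => _ /negbTE ->; rewrite mulr0.
have -> : 2 * w x y = \sum_(s : X * X | edge G s.1 s.2)
    w s.1 s.2 * ((s == (x, y))%:R + (s == (y, x))%:R).
  under eq_bigr do rewrite mulrDr.
  rewrite big_split /= !sum1 ?[edge G y x]edge_sym // [w y x]weight_sym.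
  by ring.
apply: le_trans (lerD (lexx _) IH); rewrite -big_split /=.
apply: ler_sum => -[a b] /= ab.
rewrite -mulrDr ler_wpM2l ?(ltW (weight_gt0 ab)) //.
rewrite path_flow_cons (le_trans (ler_normD _ _)) // lerD2r.
rewrite (le_trans (ler_normB _ _)) // !normr_nat [(x, y) == _]eq_sym lerD2l.
by rewrite !xpair_eqE [x == b]eq_sym [y == a]eq_sym [(b == x) && _]andbC.
Qed.

(** Induction on the number of edges of [e]: as long as [e] has a cycle, [affine_breakpoint] applied
    to the cycle flow empties one of its edges, which is deleted. *)
Lemma flow_on_tree (e : rel X) (F : X -> X -> R) : X ->
  symmetric e -> subrel e (edge G) -> connected_graph e ->
  (forall a b, F b a = - F a b) -> (forall a b, F a b != 0 -> e a b) ->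
  exists (T : rooted_spanning_tree G) (F' : X -> X -> R),
    [/\ forall a b, F' b a = - F' a b,
        forall a b, F' a b != 0 -> tree_edge T a b,
        forall a, \sum_b F' a b = \sum_b F a b & flow_cost F' <= flow_cost F].
Proof.
move=> root; have [n] := ubnP #|[pred s : X * X | e s.1 s.2]|.
elim: n e F => // n IH e F card esym esub econ Fanti Fsupp.
have [eac|] := pselect (acyclic_graph e).
  by exists (RootedSpanningTree root esub esym econ eac), F.
move=> /existsNP [c /not_implyP [szc /not_implyP [uc /negP/negbNE cyc]]].
case: c => [|x [|y [|z p]]] // in szc uc cyc *.
have {}cyc : path e x (rcons [:: y, z & p] x) by [].
pose C := path_flow R x (rcons [:: y, z & p] x).
have Cxy : C x y != 0 by exact: cycle_flow_neq0.
have Csupp a b : C a b != 0 -> e a b.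
  by case/path_flow_supp => /(steps_edge cyc) //; rewrite esym.
have [|| [a b] [t [ab Cab Fab le]]] :=
  @affine_breakpoint R _ (fun s : X * X => edge G s.1 s.2)
    (fun s => w s.1 s.2) (fun s => F s.1 s.2) (fun s => C s.1 s.2).
- by move=> s; apply: weight_gt0.
- by exists (x, y) => //=; apply/esub/Csupp.
rewrite /= in ab Cab Fab.
pose F1 u v := F u v + t * C u v.
have F1anti u v : F1 v u = - F1 u v.
  by rewrite /F1 Fanti /C path_flow_anti mulrN -opprD.
have F1supp u v : F1 u v != 0 -> del_edge e a b u v.
  move=> nz; apply/andP; split.
    apply/negPn/negP => neuv; case/eqP: nz.
    have /eqP F0 : F u v == 0 by apply: contraNT neuv; apply: Fsupp.
    have /eqP C0 : C u v == 0 by apply: contraNT neuv; apply: Csupp.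
    by rewrite /F1 F0 C0 mulr0 addr0.
  apply: contra nz; rewrite !inE !xpair_eqE => /orP[] /andP[/eqP -> /eqP ->].
    by rewrite /F1 Fab.
  by rewrite F1anti /F1 Fab oppr0.
have eab := Csupp _ _ Cab.
have [T [F' [F'anti F'supp F'div F'cost]]] :
  exists (T : rooted_spanning_tree G) (F' : X -> X -> R),
    [/\ forall a b, F' b a = - F' a b,
        forall a b, F' a b != 0 -> tree_edge T a b,
        forall a, \sum_b F' a b = \sum_b F1 a b & flow_cost F' <= flow_cost F1].
  apply: (IH (del_edge e a b)) => //.
  - apply: leq_trans (_ : _ < #|[pred s : X * X | e s.1 s.2]|)%N _ => //.
    apply: proper_card; apply/properP; split.
      by apply/fintype.subsetP => s; rewrite !inE => /andP[].
    exists (a, b); rewrite ?[_ \in pred_of_simpl _]inE //.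
    by rewrite /del_edge /= mem_head andbF.
  - exact: del_edge_sym.
  - by move=> u v /andP[/esub].
  (* The emptied edge lies on the cycle in one of its two orientations; deletion removes both. *)
  - case: (path_flow_supp Cab) => st; first exact: del_edge_connected uc cyc st.
    have cba := del_edge_connected esym econ szc uc cyc st.
    move=> u v; have := cba u v; apply: connect_sub => {}u {}v uv.
    by apply: connect1; move: uv; rewrite /del_edge /= !inE orbC.
exists T, F'; split=> // [u|]; last exact: le_trans le.
(* The cycle flow has divergence zero. *)
rewrite F'div big_split /= -mulr_sumr path_flow_div last_rcons subrr.
by rewrite mulr0 addr0.
Qed.

Lemma tree_le_routing mu nu (g : X * X -> R) (P : X -> X -> seq X) :
  is_prob mu -> is_prob nu -> coupling mu nu g ->
  (forall x y, is_path (edge G) x y (P x y)) ->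
  exists T : rooted_spanning_tree G, kantorovich (tree_dist T) mu nu
    <= transport_cost (fun x y => path_length G x (P x y)) g.
Proof.
move=> pmu pnu [[g0 g1] gmu gnu] PP.
(* The superposition of the chosen paths, weighted by [g]; the marginals of [g] give its divergence
   [mu - nu]. *)
pose F a b := \sum_(s : X * X) g s * path_flow R s.1 (P s.1 s.2) a b.
have Fanti a b : F b a = - F a b.
  by rewrite /F -sumrN; apply: eq_bigr => s _; rewrite path_flow_anti mulrN.
have Fsupp a b : F a b != 0 -> edge G a b.
  apply: contraNT => nab; rewrite /F big1 // => -[x y] _ /=.
  have [->|/path_flow_supp] := eqVneq (path_flow R x (P x y) a b) 0.
    by rewrite mulr0.
  have [exy _ _] := PP x y.
  by case=> /(steps_edge exy); rewrite ?[edge G b a]edge_sym (negbTE nab).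
have Fdiv a : \sum_b F a b = mu a - nu a.
  rewrite exchange_big /=.
  have row (s : X * X) : \sum_b g s * path_flow R s.1 (P s.1 s.2) a b =
      (s.1 == a)%:R * g s - (s.2 == a)%:R * g s.
    have [_ lP _] := PP s.1 s.2.
    by rewrite -mulr_sumr path_flow_div lP mulrC mulrBl.
  under eq_bigr do rewrite row.
  rewrite sumrB -gmu -gnu; congr (_ - _).
    rewrite -(sum_delta a (fun x => \sum_y g (x, y))).
    under [RHS]eq_bigr do rewrite mulr_sumr.
    by rewrite pair_bigA; apply: eq_bigr => -[].
  rewrite -(sum_delta a (fun y => \sum_x g (x, y))).
  under [RHS]eq_bigr do rewrite mulr_sumr.
  by rewrite exchange_big pair_bigA; apply: eq_bigr => -[].
have Fcost : flow_cost F <=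
    2 * transport_cost (fun x y => path_length G x (P x y)) g.
  rewrite /transport_cost pair_bigA /= mulr_sumr.
  pose S := \sum_s g s * flow_cost (path_flow R s.1 (P s.1 s.2)).
  apply: (@le_trans _ _ S); last first.
    apply: ler_sum => -[x y] _ /=; rewrite mulrA mulrC ler_wpM2r //.
    by apply: path_flow_cost; case: (PP x y).
  under [leRHS]eq_bigr do rewrite mulr_sumr.
  rewrite exchange_big /=; apply: ler_sum => -[a b] ab /=.
  under eq_bigr do rewrite mulrCA.
  rewrite -mulr_sumr ler_wpM2l ?(ltW (weight_gt0 ab)) //.
  apply: le_trans (ler_norm_sum _ _ _) _.
  by apply: ler_sum => s _; rewrite normrM (ger0_norm (g0 s)).
(* [X] is nonempty because [mu] has total mass 1. *)
have [root _] : exists x : X, true.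
  have [_ mu1] := pmu; apply/existsP; apply: contraT => /existsPn nX.
  have := mu1; rewrite big1 => [/eqP|x]; first by rewrite eq_sym oner_eq0.
  by have := nX x.
have [T [F' [F'anti F'supp F'div F'cost]]] :=
  flow_on_tree root (@edge_sym _ _ G) (fun _ _ h => h)
    (@edge_connected _ _ G) Fanti Fsupp.
exists T.
(* The positive part of [F']: a nonnegative flow with the same divergence, each edge being used in
   one direction only. *)
pose f (s : X * X) := (`|F' s.1 s.2| + F' s.1 s.2) / 2.
have f0 s : 0 <= f s.
  by rewrite divr_ge0 // addrC -lerBlDr sub0r lerNnormlW.
have fdiv x : \sum_y f (x, y) - \sum_y f (y, x) = mu x - nu x.
  rewrite -Fdiv -F'div -sumrB; apply: eq_bigr => y _.
  by rewrite /f /= (F'anti x y) normrN; field.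
have [h ch hle] :=
  flow_to_coupling (tree_dist0 T) (tree_dist_triangle T) pmu pnu f0 fdiv.
apply: le_trans (kantorovich_tree_le T ch) (le_trans hle _).
rewrite -(ler_pM2l (ltr0n _ 2)); apply: le_trans Fcost; apply: le_trans F'cost.
rewrite /transport_cost pair_bigA /= mulr_sumr.
(* By antisymmetry the signed sum vanishes, so [|F'|] can be replaced by [|F'| + F'], that is
   [2 * f], in the cost. *)
have wF0 : \sum_(s : X * X | edge G s.1 s.2) w s.1 s.2 * F' s.1 s.2 = 0.
  set S := LHS; have : S = - S.
    rewrite {1}/S (reindex_inj (inv_inj (@swap_pairK X X))) /S -sumrN /=.
    apply: eq_big => [s|s _]; first by rewrite edge_sym.
    by rewrite weight_sym F'anti mulrN.
  by lra.
have -> : flow_cost F' = \sum_(s : X * X | edge G s.1 s.2)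
    w s.1 s.2 * (`|F' s.1 s.2| + F' s.1 s.2).
  by under [RHS]eq_bigr do rewrite mulrDr; rewrite big_split /= wF0 addr0.
rewrite [leRHS]big_mkcond /=.
apply: ler_sum => -[a b] _ /=.
have [F0|nz] := eqVneq (F' a b) 0.
  by rewrite /f /= F0 normr0 addr0 mul0r !mulr0; case: ifP.
rewrite (tree_sub (F'supp _ _ nz)) mulrCA [2 * _]mulrC divfK ?pnatr_eq0 //.
rewrite ler_wpM2r ?tree_dist_edge ?F'supp //.
by have := f0 (a, b); rewrite /f /= pmulr_lge0 // invr_gt0.
Qed.

End Trees.

(** * Optimality for the graph distance *)

Lemma kantorovichE (R : realType) (X : finType) (d : X -> X -> R) mu nu gamma :
  optimal_plan d mu nu gamma -> kantorovich d mu nu = transport_cost d gamma.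
Proof.
move=> [cgamma opt]; apply/le_anti/andP; split.
  apply: ge_inf; last by exists gamma.
  by exists (transport_cost d gamma) => _ [g cg <-]; apply: opt.
apply: lb_le_inf => [|_ [g cg <-]]; last exact: opt.
by exists (transport_cost d gamma), gamma.
Qed.

Theorem theorem3p1 (R : realType) (X : finType) (G : weighted_graph R X)
    (mu nu : X -> R) (hmu : is_prob mu) (hnu : is_prob nu)
    (T : rooted_spanning_tree G)
    (hT : forall T' : rooted_spanning_tree G,
      kantorovich (tree_dist T) mu nu <= kantorovich (tree_dist T') mu nu)
    (gamma : X * X -> R)
    (hgamma : optimal_plan (tree_dist T) mu nu gamma) :
  [/\ optimal_plan (graph_dist G) mu nu gamma,
      kantorovich (graph_dist G) mu nu
        = \sum_x \sum_y graph_dist G x y * gamma (x, y)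
    & forall x y : X, 0 < gamma (x, y) ->
        [/\ graph_dist G x y = tree_dist T x y,
            geodesic_path G x y (tree_path T x y)
          & forall a b : X, (a, b) \in steps x (tree_path T x y) ->
              geodesic_edge G a b]].
Proof.
have [cgamma opt] := hgamma.
have KT : kantorovich (tree_dist T) mu nu = transport_cost (tree_dist T) gamma.
  exact: kantorovichE.
have key g : coupling mu nu g ->
    transport_cost (tree_dist T) gamma <= transport_cost (graph_dist G) g.
  move=> cg; have [[g0 g1] _ _] := cg; rewrite -KT.
  apply/ler_addgt0Pr => eps eps0.
  have /choice [P PP] : forall s : X * X, exists p,
      is_path (edge G) s.1 s.2 p /\
      path_length G s.1 p <= graph_dist G s.1 s.2 + eps.
    move=> s; have [p pp /ltW lp] := graph_dist_adherent G s.1 s.2 eps0.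
    by exists p.
  have [T' leT'] := tree_le_routing hmu hnu cg (fun x y => (PP (x, y)).1).
  apply: le_trans (hT T') (le_trans leT' _).
  (* Since [g] has total mass 1, an excess length of [eps] on each path costs at most [eps]
     altogether. *)
  rewrite -[eps]mulr1 -g1 /transport_cost !pair_bigA mulr_sumr -big_split /=.
  apply: ler_sum => -[x y] _ /=.
  by rewrite -mulrDl ler_wpM2r // (PP (x, y)).2.
have le_cost :
    transport_cost (graph_dist G) gamma <= transport_cost (tree_dist T) gamma.
  have [[gamma0 _] _ _] := cgamma.
  apply: ler_sum => x _; apply: ler_sum => y _.
  by rewrite ler_wpM2r ?graph_dist_le_tree.
have optG : optimal_plan (graph_dist G) mu nu gamma.
  by split=> // g /key; apply: le_trans.
split=> //; first exact: kantorovichE.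
have geo x y : 0 < gamma (x, y) -> graph_dist G x y = tree_dist T x y.
  have [[gamma0 _] _ _] := cgamma.
  have gap_ge0 (s : X * X) : true ->
      0 <= (tree_dist T s.1 s.2 - graph_dist G s.1 s.2) * gamma s.
    by move=> _; rewrite mulr_ge0 // subr_ge0 graph_dist_le_tree.
  (* Taking [g = gamma] in [key] bounds this sum of nonnegative terms by 0, so each term
     vanishes. *)
  have gap0 : \sum_s (tree_dist T s.1 s.2 - graph_dist G s.1 s.2) * gamma s = 0.
    apply/le_anti; rewrite sumr_ge0 ?andbT //.
    have := key _ cgamma; rewrite /transport_cost !pair_bigA -subr_le0 -sumrB.
    by under eq_bigr do rewrite -mulrBl -surjective_pairing.
  move=> gxy.
  have /eqP : (tree_dist T x y - graph_dist G x y) * gamma (x, y) = 0.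
    exact: (psumr_eq0P gap_ge0 gap0 (i := (x, y)) isT).
  by rewrite mulf_eq0 (gt_eqF gxy) orbF subr_eq0 => /eqP.
move=> x y gxy; have geod : geodesic_path G x y (tree_path T x y).
  split; first exact: tree_is_path (tree_pathP T x y).
  by rewrite (geo _ _ gxy).
split=> //; first exact: geo.
by move=> a b ab; exists x, y, (tree_path T x y); split=> //; left.
Qed.
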